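(* Let $n\ge 1$ and let $T_1,\dots,T_n$ be independent Bernoulli random variables, $T_i$ having parameter $q_i=P(T_i=1)\in[0,1]$. Let $\overline T=\frac1n\sum_{i=1}^n T_i$, $\overline q=\frac1n\sum_{i=1}^n q_i$, and let $0\le\alpha\le 1/2$. Define the random variable $$\hat q=\begin{cases} I^{-1}_{\alpha}\big(n\overline T-1,\; n(1-\overline T)+2\big) & \text{if } n\overline T\ge 1,\\ 0 & \text{if } n\overline T=0.\end{cases}$$ Then $P(\hat q\le \overline q)\ge 1-\alpha$, i.e. $[\hat q,1]$ is a confidence interval for $\overline q$ with confidence level $1-\alpha$.
   Context: $I_x(\mathsf a,\mathsf b)$ denotes the regularized incomplete Beta function (the cumulative distribution function at $x$ of the Beta$(\mathsf a,\mathsf b)$ distribution). $I^{-1}_\alpha(\mathsf a,\mathsf b)$ denotes its inverse in the first variable, i.e. the value $x\in[0,1]$ with $I_x(\mathsf a,\mathsf b)=\alpha$. When the first argument equals $0$ (the case $n\overline T=1$), $I^{-1}_\alpha(0,\mathsf b)$ is understood as $0$ (the limiting value, since $I_x(0,\mathsf b)=1$ for all $x>0$). *)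

(* Defs.v *)
From Stdlib Require Import Reals Lra Lia List.
Import ListNotations.
Open Scope R_scope.

Definition beta_kernel (a b : nat) (t : R) : R :=
  t ^ (a - 1) * (1 - t) ^ (b - 1).

Definition is_incbeta (a b : nat) (x v : R) : Prop :=
  exists (p1 : Riemann_integrable (beta_kernel a b) 0 x)
         (p2 : Riemann_integrable (beta_kernel a b) 0 1),
    v = RiemannInt p1 / RiemannInt p2.

Definition is_incbeta_inv (a b : nat) (alpha x : R) : Prop :=
  0 <= x <= 1 /\ is_incbeta a b x alpha.

Fixpoint bvecs (n : nat) : list (list bool) :=
  match n with
  | O => [[]]
  | S m => map (cons true) (bvecs m) ++ map (cons false) (bvecs m)
  end.

Fixpoint bern_weight (q : nat -> R) (i : nat) (t : list bool) : R :=
  match t with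
  | [] => 1
  | b :: t' => (if b then q i else 1 - q i) * bern_weight q (S i) t'
  end.

Definition nsucc (t : list bool) : nat := length (filter (fun b => b) t).

(* P(E(n Tbar)) for independent T_i ~ Bernoulli(q i), i = 0..n-1. *)
Definition prob_sum_event (n : nat) (q : nat -> R) (E : nat -> Prop)
  (Edec : forall k, {E k} + {~ E k}) : R :=
  fold_right Rplus 0
    (map (fun t => if Edec (nsucc t) then bern_weight q 0 t else 0) (bvecs n)).

Definition qbar (n : nat) (q : nat -> R) : R := sum_f_R0 q (n - 1) / INR n.

(* Main.v *)
(* For integers [1 <= m <= n], [I_x(m, n - m + 1) = P(Bin(n, x) >= m)], so [qhat k] is
   the [x] with [P(Bin(n, x) >= k - 1) = alpha]. Let [p = qbar] and let [k] be least with
   [qhat k > p]: the bad event is contained in [S >= k], where [S] is the number of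
   successes, and [P(Bin(n, p) >= k - 1) < alpha <= 1/2].

   A binomial variable satisfies [P(Bin(n, p) >= m) >= 1/2] as soon as [m <= n p], so
   [k - 1 > n p]. In that range Hoeffding (1956) gives [P(S >= k) <= P(Bin(n, p) >= k)].
   His argument: as a function of two of the parameters with fixed sum, [P(S >= k)] is
   affine in their product, with slope [P(S' = k - 2) - P(S' = k - 1)], [S'] being the
   number of successes in the other trials. Hence, at a maximiser with the least sum of
   squares, this slope is negative for every pair of distinct parameters, and the
   parameters lie in [{0, a, 1}]; the binomial recurrence then excludes a negative slope. *)
Require Import Defs.
From Stdlib Require Import Reals Lra Lia List Permutation Classical IndefiniteDescription.
From Coquelicot Require Import Coquelicot.
Import List ListNotations.
Open Scope R_scope.

(** * Tails and weights of a sum of independent Bernoulli trials *)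

Definition lsum (l : list R) : R := fold_right Rplus 0 l.

Lemma lsum_cons (x : R) (l : list R) : lsum (x :: l) = x + lsum l.
Proof. reflexivity. Qed.

Definition unit_list (l : list R) : Prop := Forall (fun x => 0 <= x <= 1) l.

(* [pb_tail l k] is the probability that at least [k] of the independent
   Bernoulli trials with parameters [l] succeed. *)
Fixpoint pb_tail (l : list R) (k : nat) : R :=
  match l, k with
  | _, O => 1
  | [], S _ => 0
  | x :: l', S k' => x * pb_tail l' k' + (1 - x) * pb_tail l' (S k')
  end.

Definition pb_pmf (l : list R) (j : nat) : R := pb_tail l j - pb_tail l (S j).

Lemma pb_tail_0 (l : list R) : pb_tail l 0 = 1.
Proof. destruct l; reflexivity. Qed.

Lemma pb_tail_cons (x : R) (l : list R) (k : nat) :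
  pb_tail (x :: l) (S k) = x * pb_tail l k + (1 - x) * pb_tail l (S k).
Proof. reflexivity. Qed.

Lemma pb_pmf_cons_0 (x : R) (l : list R) :
  pb_pmf (x :: l) 0 = (1 - x) * pb_pmf l 0.
Proof. unfold pb_pmf. rewrite pb_tail_cons, !pb_tail_0. ring. Qed.

Lemma pb_pmf_cons_S (x : R) (l : list R) (j : nat) :
  pb_pmf (x :: l) (S j) = x * pb_pmf l j + (1 - x) * pb_pmf l (S j).
Proof. unfold pb_pmf. rewrite !pb_tail_cons. ring. Qed.

Lemma pb_pmf_ge0 (l : list R) (j : nat) : unit_list l -> 0 <= pb_pmf l j.
Proof.
  intros H; revert j; induction H as [|x l Hx Hl IH]; intros j.
  - unfold pb_pmf; destruct j; simpl; lra.
  - destruct j as [|j].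
    + rewrite pb_pmf_cons_0. specialize (IH 0%nat). nra.
    + rewrite pb_pmf_cons_S. pose proof (IH j). pose proof (IH (S j)). nra.
Qed.

Lemma pb_tail_decr (l : list R) (k : nat) :
  unit_list l -> pb_tail l (S k) <= pb_tail l k.
Proof. intros H. pose proof (pb_pmf_ge0 l k H) as H0. unfold pb_pmf in H0. lra. Qed.

Lemma pb_tail_le1 (l : list R) (k : nat) : unit_list l -> pb_tail l k <= 1.
Proof.
  intros H; induction k as [|k IH].
  - rewrite pb_tail_0; lra.
  - pose proof (pb_tail_decr l k H); lra.
Qed.

Lemma pb_tail_gt_length (l : list R) (k : nat) :
  (length l < k)%nat -> pb_tail l k = 0.
Proof.
  revert k; induction l as [|x l IH]; intros [|k] H; simpl in H; try lia.
  - reflexivity.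
  - rewrite pb_tail_cons, !IH by lia. ring.
Qed.

Lemma pb_pmf_gt_length (l : list R) (j : nat) :
  (length l < j)%nat -> pb_pmf l j = 0.
Proof. intros H. unfold pb_pmf. rewrite !pb_tail_gt_length by lia. ring. Qed.

Lemma pb_tail_perm (l l' : list R) (k : nat) :
  Permutation l l' -> pb_tail l k = pb_tail l' k.
Proof.
  intros H; revert k; induction H as [|x l l' _ IH|x y l|l l' l'' _ IH _ IH']; intros k.
  - reflexivity.
  - destruct k as [|k]; [reflexivity|]. rewrite !pb_tail_cons, !IH. ring.
  - destruct k as [|[|k]]; [reflexivity| |].
    + rewrite !pb_tail_cons, !pb_tail_0. ring.
    + rewrite !pb_tail_cons. ring.
  - rewrite IH; apply IH'.
Qed.

Lemma lsum_perm (l l' : list R) : Permutation l l' -> lsum l = lsum l'.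
Proof. induction 1; simpl in *; lra. Qed.

Lemma unit_list_perm (l l' : list R) :
  Permutation l l' -> unit_list l -> unit_list l'.
Proof. intros H; apply Permutation_Forall; exact H. Qed.

Lemma lsum_repeat (p : R) (n : nat) : lsum (repeat p n) = INR n * p.
Proof.
  induction n as [|n IH]; [simpl; ring|].
  rewrite S_INR. simpl repeat. rewrite lsum_cons. lra.
Qed.

Lemma unit_list_repeat (p : R) (n : nat) : 0 <= p <= 1 -> unit_list (repeat p n).
Proof. intros H. apply Forall_forall. intros x Hx. apply repeat_spec in Hx. now subst. Qed.

(** * Recurrence of the weights when the parameters lie in [{0, a, 1}] *)

(* The case [s = 0] is the recurrence of the binomial weights, which ones shift. *)
Lemma pb_pmf_three_valued (a : R) (l : list R) :
  a <> 1 -> a <> 0 ->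
  (forall x, In x l -> x = 0 \/ x = a \/ x = 1) ->
  let s := INR (count_occ Req_dec_T l 1) in
  let m := INR (count_occ Req_dec_T l a) in
  lsum l = s + m * a /\ s * pb_pmf l 0 = 0 /\
  forall j, (1 - a) * (INR j + 1 - s) * pb_pmf l (S j)
            = a * (m + s - INR j) * pb_pmf l j.
Proof.
  intros Ha1 Ha0; induction l as [|x l IH]; intros Hl s m.
  - unfold s, m; simpl. split; [ring|split; [ring|]].
    intros [|j]; unfold pb_pmf; simpl; ring.
  - destruct IH as (Hsum & H0 & Hrec); [intros y Hy; apply Hl; now right|].
    set (s' := INR (count_occ Req_dec_T l 1)) in *.
    set (m' := INR (count_occ Req_dec_T l a)) in *.
    rewrite lsum_cons, Hsum, pb_pmf_cons_0.
    destruct (Hl x (or_introl eq_refl)) as [->|[->| ->]].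
    + assert (Es : s = s') by (unfold s; rewrite count_occ_cons_neq by lra; reflexivity).
      assert (Em : m = m') by (unfold m; rewrite count_occ_cons_neq by lra; reflexivity).
      rewrite Es, Em. split; [ring|split; [lra|]].
      intros [|j]; rewrite pb_pmf_cons_S, ?pb_pmf_cons_0, ?pb_pmf_cons_S.
      * specialize (Hrec 0%nat). lra.
      * specialize (Hrec (S j)). lra.
    + assert (Es : s = s') by (unfold s; rewrite count_occ_cons_neq by lra; reflexivity).
      assert (Em : m = m' + 1)
        by (unfold m; rewrite count_occ_cons_eq by reflexivity; apply S_INR).
      rewrite Es, Em. split; [ring|split; [nra|]].
      intros [|j]; rewrite pb_pmf_cons_S, ?pb_pmf_cons_0, ?pb_pmf_cons_S.
      * specialize (Hrec 0%nat). simpl INR in *.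
        transitivity ((1 - a) * (1 - s') * a * pb_pmf l 0
                      + (1 - a) * ((1 - a) * (0 + 1 - s') * pb_pmf l 1)); [ring|].
        rewrite Hrec.
        (* The remainder is a multiple of [s' * pb_pmf l 0], which vanishes: a parameter equal to 1
           rules out zero successes. *)
        transitivity (a * (m' + 1 + s' - 0) * ((1 - a) * pb_pmf l 0)
                      - (1 - a) * a * (s' * pb_pmf l 0)); [ring|rewrite H0; ring].
      * pose proof (Hrec (S j)) as H1. pose proof (Hrec j) as H2. rewrite S_INR in *.
        transitivity ((1 - a) * (INR j + 1 + 1 - s') * a * pb_pmf l (S j)
          + (1 - a) * ((1 - a) * (INR j + 1 + 1 - s') * pb_pmf l (S (S j)))); [ring|].
        rewrite H1.
        transitivity (a * (a * (m' + s' - INR j) * pb_pmf l j)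
          + a * (m' + 1 + s' - (INR j + 1)) * (1 - a) * pb_pmf l (S j)); [|ring].
        rewrite <- H2. ring.
    + assert (Es : s = s' + 1)
        by (unfold s; rewrite count_occ_cons_eq by reflexivity; apply S_INR).
      assert (Em : m = m') by (unfold m; rewrite count_occ_cons_neq by lra; reflexivity).
      rewrite Es, Em. split; [ring|split; [ring|]].
      intros [|j]; rewrite pb_pmf_cons_S, ?pb_pmf_cons_0, ?pb_pmf_cons_S.
      * simpl INR.
        transitivity (- (1 - a) * (s' * pb_pmf l 0)); [ring|rewrite H0; ring].
      * specialize (Hrec j). rewrite S_INR.
        transitivity ((1 - a) * (INR j + 1 - s') * pb_pmf l (S j)); [ring|].
        rewrite Hrec. ring.
Qed.

(** If [s < j + 1], an increase forces [(1 - a) (j + 1 - s) < a (m + s - j)] in the recurrence,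
    which rearranges to the bound since the sum is [s + m a]. If [j + 1 <= s], the bound follows
    from [0 <= m] and [0 < a]. *)
Lemma pb_pmf_increase (a : R) (l : list R) (j : nat) :
  0 < a < 1 -> (forall x, In x l -> x = 0 \/ x = a \/ x = 1) ->
  pb_pmf l j < pb_pmf l (S j) -> INR j + 1 < lsum l + a.
Proof.
  intros Ha Hl Hlt.
  destruct (pb_pmf_three_valued a l) as (Hsum & _ & Hrec); try lra; [exact Hl|].
  specialize (Hrec j). rewrite Hsum.
  assert (Hp : 0 <= pb_pmf l j).
  { apply pb_pmf_ge0, Forall_forall. intros x Hx.
    destruct (Hl x Hx) as [->|[->| ->]]; lra. }
  set (s := INR (count_occ Req_dec_T l 1)) in *.
  set (m := INR (count_occ Req_dec_T l a)) in *.
  assert (Hm : 0 <= m) by apply pos_INR.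
  destruct (Rle_lt_dec (INR j + 1) s) as [Hs|Hs]; [nra|].
  apply Rnot_le_lt; intros Hc.
  assert (H1 : (1 - a) * (INR j + 1 - s) * pb_pmf l j
               < (1 - a) * (INR j + 1 - s) * pb_pmf l (S j))
    by (apply Rmult_lt_compat_l; [apply Rmult_lt_0_compat|]; lra).
  rewrite Hrec in H1. nra.
Qed.

Lemma binomial_pmf_rec (p : R) (n j : nat) :
  0 < p < 1 ->
  (1 - p) * (INR j + 1) * pb_pmf (repeat p n) (S j)
  = p * (INR n - INR j) * pb_pmf (repeat p n) j.
Proof.
  intros Hp.
  destruct (pb_pmf_three_valued p (repeat p n)) as (_ & _ & Hrec); try lra.
  { intros x Hx. apply repeat_spec in Hx. tauto. }
  specialize (Hrec j).
  rewrite (count_occ_repeat_eq _ n (eq_refl p)), count_occ_repeat_neq in Hrec by lra.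
  simpl (INR 0) in Hrec. lra.
Qed.

(** * Sequential compactness and continuity for lists of reals *)

(** Entrywise convergence of lists that all have the length of the limit; recursing on the limit
    makes continuity proofs inductions on it. *)
Fixpoint list_cvg (u : nat -> list R) (l : list R) : Prop :=
  match l with
  | [] => forall k, u k = []
  | y :: l' => exists (v : nat -> R) (w : nat -> list R),
      (forall k, u k = v k :: w k) /\ is_lim_seq v y /\ list_cvg w l'
  end.

Definition list_seq_continuous (F : list R -> R) : Prop :=
  forall u l, list_cvg u l -> is_lim_seq (fun k => F (u k)) (F l).

(** The indices [phi k] are only asked to tend to infinity, which already preserves limits and
    spares building an increasing extraction. *)
Definition list_seq_compact (K : list R -> Prop) : Prop :=
  forall u, (forall k, K (u k)) ->
  exists (phi : nat -> nat) l,
    (forall k, (k <= phi k)%nat) /\ K l /\ list_cvg (fun k => u (phi k)) l.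

Lemma filterlim_ge_id (phi : nat -> nat) :
  (forall k, (k <= phi k)%nat) -> filterlim phi eventually eventually.
Proof.
  intros H P [N HN]. exists N. intros k Hk. apply HN. specialize (H k). lia.
Qed.

Lemma list_cvg_subseq (u : nat -> list R) (l : list R) (phi : nat -> nat) :
  (forall k, (k <= phi k)%nat) -> list_cvg u l -> list_cvg (fun k => u (phi k)) l.
Proof.
  intros Hphi; revert u; induction l as [|y l IH]; intros u; simpl; [auto|].
  intros (v & w & Hu & Hv & Hw).
  exists (fun k => v (phi k)), (fun k => w (phi k)).
  split; [auto|split; [|auto]].
  apply is_lim_seq_subseq; [apply filterlim_ge_id|]; auto.
Qed.

Lemma bolzano_weierstrass_unit (v : nat -> R) :
  (forall k, 0 <= v k <= 1) ->
  exists (phi : nat -> nat) (y : R),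
    (forall k, (k <= phi k)%nat) /\ 0 <= y <= 1 /\ is_lim_seq (fun k => v (phi k)) y.
Proof.
  intros Hv.
  destruct (Bolzano_Weierstrass v (fun c => 0 <= c <= 1)) as [y Hy];
    [apply compact_P3|exact Hv|].
  (* Past each [k], pick an index whose value lies within [1 / (k + 1)] of the cluster point [y]. *)
  destruct (functional_choice (fun k p => (k <= p)%nat /\ Rabs (v p - y) < / (INR k + 1)))
    as [phi Hphi].
  { intros k.
    assert (Hd : 0 < / (INR k + 1))
      by (apply Rinv_0_lt_compat; pose proof (pos_INR k); lra).
    apply (Hy (fun z => Rabs (z - y) < / (INR k + 1)) k).
    exists (mkposreal _ Hd). intros z Hz. exact Hz. }
  assert (Hlim : is_lim_seq (fun k => v (phi k)) y).
  { apply is_lim_seq_spec. intros eps.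
    destruct (archimed_cor1 eps (cond_pos eps)) as (N & HN & HN0).
    exists N. intros k Hk.
    apply Rlt_trans with (1 := proj2 (Hphi k)).
    apply Rle_lt_trans with (2 := HN).
    apply Rinv_le_contravar; [now apply lt_0_INR|].
    apply le_INR in Hk. lra. }
  exists phi, y. split; [intros k; apply Hphi|split; [|exact Hlim]].
  split.
  - apply (is_lim_seq_le (fun _ => 0) (fun k => v (phi k)) 0 y);
      [intros k; apply Hv|apply is_lim_seq_const|exact Hlim].
  - apply (is_lim_seq_le (fun k => v (phi k)) (fun _ => 1) y 1);
      [intros k; apply Hv|exact Hlim|apply is_lim_seq_const].
Qed.

(** Induction on the dimension: extract for the tails first, then for the heads along that
    extraction. *)
Lemma list_seq_compact_cube (n : nat) :
  list_seq_compact (fun l => length l = n /\ unit_list l).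
Proof.
  induction n as [|n IH]; intros u Hu.
  - exists (fun k => k), []. split; [auto|split; [repeat constructor|]].
    intros k. apply length_zero_iff_nil, Hu.
  - assert (Hc : forall k, u k = hd 0 (u k) :: tl (u k)).
    { intros k. destruct (Hu k) as [Hk _]. destruct (u k); [discriminate|reflexivity]. }
    assert (Hht : forall k, 0 <= hd 0 (u k) <= 1
                    /\ length (tl (u k)) = n /\ unit_list (tl (u k))).
    { intros k. destruct (Hu k) as [Hk Hk']. rewrite Hc in Hk, Hk'.
      inversion Hk'; subst. simpl in Hk. auto. }
    destruct (IH (fun k => tl (u k))) as (phi & l & Hphi & Hl & Hcv);
      [intros k; apply Hht|].
    destruct (bolzano_weierstrass_unit (fun k => hd 0 (u (phi k))))
      as (psi & y & Hpsi & Hy & Hcy); [intros k; apply Hht|].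
    exists (fun k => phi (psi k)), (y :: l).
    split; [|split; [split; [simpl; now rewrite (proj1 Hl)|constructor; tauto]|]].
    + intros k. specialize (Hpsi k). specialize (Hphi (psi k)). lia.
    + exists (fun k => hd 0 (u (phi (psi k)))), (fun k => tl (u (phi (psi k)))).
      split; [auto|split; [exact Hcy|]].
      apply (list_cvg_subseq (fun k => tl (u (phi k)))); assumption.
Qed.

Lemma list_seq_compact_max (K : list R -> Prop) (F : list R -> R) (M : R) :
  list_seq_compact K -> list_seq_continuous F ->
  (exists l, K l) -> (forall l, K l -> F l <= M) ->
  exists l, K l /\ forall l', K l' -> F l' <= F l.
Proof.
  intros HK HF [l0 Hl0] HM.
  destruct (completeness (fun y => exists l, K l /\ y = F l)) as [b [Hub Hlub]].
  { exists M. intros y (l & Hl & ->). auto. }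
  { exists (F l0), l0. auto. }
  destruct (functional_choice (fun k l => K l /\ b - / (INR k + 1) < F l)) as [u Hu].
  { intros k. apply NNPP. intros Hn.
    assert (Hd : 0 < / (INR k + 1))
      by (apply Rinv_0_lt_compat; pose proof (pos_INR k); lra).
    assert (b <= b - / (INR k + 1)); [|lra].
    apply Hlub. intros y (l & Hl & ->). apply Rnot_lt_le. intros Hlt.
    apply Hn. exists l. auto. }
  assert (HFu : is_lim_seq (fun k => F (u k)) b).
  { apply is_lim_seq_spec. intros eps.
    destruct (archimed_cor1 eps (cond_pos eps)) as (N & HN & HN0).
    exists N. intros k Hk. destruct (Hu k) as [Hk1 Hk2].
    assert (F (u k) <= b) by (apply Hub; eauto).
    assert (/ (INR k + 1) <= / INR N).
    { apply Rinv_le_contravar; [now apply lt_0_INR|]. apply le_INR in Hk. lra. }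
    apply Rabs_def1; lra. }
  destruct (HK u) as (phi & l & Hphi & Hl & Hcv); [intros k; apply Hu|].
  exists l. split; [exact Hl|]. intros l' Hl'.
  replace (F l) with b; [apply Hub; eauto|].
  assert (H1 := is_lim_seq_subseq _ _ phi (filterlim_ge_id phi Hphi) HFu).
  assert (H2 := HF _ _ Hcv).
  apply is_lim_seq_unique in H1, H2. rewrite H1 in H2. now injection H2.
Qed.

(** This serves twice: to fix the sum of the parameters, and then to restrict to the maximisers of
    the tail before minimising the sum of squares. *)
Lemma list_seq_compact_level (K : list R -> Prop) (F : list R -> R) (c : R) :
  list_seq_compact K -> list_seq_continuous F ->
  list_seq_compact (fun l => K l /\ F l = c).
Proof.
  intros HK HF u Hu.
  destruct (HK u) as (phi & l & Hphi & Hl & Hcv); [intros k; apply Hu|].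
  exists phi, l. split; [exact Hphi|split; [split; [exact Hl|]|exact Hcv]].
  assert (H1 := HF _ _ Hcv).
  apply (is_lim_seq_ext _ (fun _ => c)) in H1; [|intros k; apply Hu].
  apply is_lim_seq_unique in H1. rewrite Lim_seq_const in H1. now injection H1.
Qed.

Lemma lsum_map_continuous (g : R -> R) :
  continuity g -> list_seq_continuous (fun l => lsum (map g l)).
Proof.
  intros Hg u l; revert u; induction l as [|y l IH]; intros u; simpl.
  - intros Hu. apply (is_lim_seq_ext (fun _ => 0)); [|apply is_lim_seq_const].
    intros k. rewrite Hu. reflexivity.
  - intros (v & w & Hu & Hv & Hw).
    apply (is_lim_seq_ext (fun k => g (v k) + lsum (map g (w k)))).
    + intros k. rewrite Hu. reflexivity.
    + apply is_lim_seq_plus'; [|apply IH, Hw].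
      apply is_lim_seq_continuous; [apply Hg|exact Hv].
Qed.

Lemma pb_tail_continuous (k : nat) : list_seq_continuous (fun l => pb_tail l k).
Proof.
  intros u l; revert k u; induction l as [|y l IH]; intros k u; simpl.
  - intros Hu. apply (is_lim_seq_ext (fun _ => pb_tail [] k)); [|apply is_lim_seq_const].
    intros i. rewrite Hu. reflexivity.
  - intros (v & w & Hu & Hv & Hw).
    destruct k as [|k].
    + apply (is_lim_seq_ext (fun _ => 1)); [|apply is_lim_seq_const].
      intros i. now rewrite pb_tail_0.
    + apply (is_lim_seq_ext
               (fun i => v i * pb_tail (w i) k + (1 - v i) * pb_tail (w i) (S k))).
      * intros i. rewrite Hu. reflexivity.
      * apply is_lim_seq_plus'; apply is_lim_seq_mult'; auto.
        apply is_lim_seq_minus'; [apply is_lim_seq_const|exact Hv].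
Qed.

(** * Maximisers of the tail at fixed sum *)

(* Ties are broken by the sum of squares, so that even neutral averagings of two
   entries of a maximiser are excluded. *)
Definition pb_maximiser (k : nat) (l : list R) : Prop :=
  unit_list l /\
  forall l', length l' = length l -> unit_list l' -> lsum l' = lsum l ->
    pb_tail l' k <= pb_tail l k /\
    (pb_tail l' k = pb_tail l k -> lsum (map Rsqr l) <= lsum (map Rsqr l')).

Lemma pb_maximiser_exists (n k : nat) (c : R) :
  (exists l, length l = n /\ unit_list l /\ lsum l = c) ->
  exists l, length l = n /\ lsum l = c /\ pb_maximiser k l.
Proof.
  intros (l0 & Hl0).
  (* The sum is written with [map id] to fit [lsum_map_continuous]. *)
  set (K := fun l => (length l = n /\ unit_list l) /\ lsum (map id l) = c).
  assert (HK : list_seq_compact K).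
  { apply (list_seq_compact_level _ (fun l => lsum (map id l)));
      [apply list_seq_compact_cube|apply lsum_map_continuous].
    apply derivable_continuous, derivable_id. }
  destruct (list_seq_compact_max K (fun l => pb_tail l k) 1 HK) as (l1 & Hl1 & Hmax).
  { apply pb_tail_continuous. }
  { exists l0. unfold K. rewrite map_id. tauto. }
  { intros l [[_ Hl] _]. now apply pb_tail_le1. }
  (* Second optimisation, among the maximisers of the tail: minimising the sum of squares is
     maximising its opposite, bounded by 0. *)
  destruct (list_seq_compact_max (fun l => K l /\ pb_tail l k = pb_tail l1 k)
              (fun l => lsum (map (fun x => - Rsqr x) l)) 0) as (l & [Hl Heq] & Hmin).
  { apply list_seq_compact_level; [exact HK|apply pb_tail_continuous]. }
  { apply lsum_map_continuous, continuity_opp, derivable_continuous, derivable_Rsqr. }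
  { now exists l1. }
  { intros l _. induction l as [|x l IH]; [apply Rle_refl|].
    rewrite map_cons, lsum_cons.
    pose proof (Rle_0_sqr x). lra. }
  assert (Hopp : forall l, lsum (map (fun x => - Rsqr x) l) = - lsum (map Rsqr l)).
  { clear. induction l as [|x l IH]; [simpl; ring|].
    rewrite !map_cons, !lsum_cons, IH. ring. }
  unfold K in *. rewrite map_id in Hl. exists l. destruct Hl as [[Hlen Hu] Hsum].
  split; [exact Hlen|split; [exact Hsum|split; [exact Hu|]]].
  rewrite Hlen, Hsum, Heq. intros l' H1 H2 H3.
  assert (Hl' : (length l' = n /\ unit_list l') /\ lsum (map id l') = c)
    by (rewrite map_id; auto).
  split; [now apply Hmax|]. intros H4.
  specialize (Hmin l' (conj Hl' H4)). rewrite !Hopp in Hmin. lra.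
Qed.

(** Conditioning on two trials isolates the product [x * y], the only varying term when [x + y] is
    fixed; its coefficient is the slope in Hoeffding's argument. *)
Lemma pb_tail_cons2 (x y : R) (l : list R) (k : nat) :
  pb_tail (x :: y :: l) (S (S k)) =
  pb_tail l (S (S k)) + (x + y) * pb_pmf l (S k)
  + x * y * (pb_pmf l k - pb_pmf l (S k)).
Proof. unfold pb_pmf. rewrite !pb_tail_cons. ring. Qed.

(** Distinct entries sit at different positions, so both can be brought to the front. *)
Lemma Permutation_pair_in (l : list R) (x y : R) :
  In x l -> In y l -> x <> y -> exists l', Permutation l (x :: y :: l').
Proof.
  intros Hx Hy Hxy.
  destruct (in_split x l Hx) as (l1 & l2 & ->).
  assert (Hy' : In y (l1 ++ l2)).
  { apply in_app_or in Hy. apply in_or_app.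
    destruct Hy as [Hy|[Hy|Hy]]; [now left|congruence|now right]. }
  destruct (in_split y (l1 ++ l2) Hy') as (l3 & l4 & E).
  exists (l3 ++ l4). rewrite <- Permutation_middle, E, <- Permutation_middle. reflexivity.
Qed.

(** The modified list is a competitor with the same sum, and its tail differs by the change of
    product times the slope. In a tie the squares decide: at fixed sum, a larger sum of squares
    means a smaller product. *)
Lemma pb_maximiser_transfer (k : nat) (l : list R) (x y x' y' : R) (l' : list R) :
  pb_maximiser (S (S k)) l -> Permutation l (x :: y :: l') ->
  0 <= x' <= 1 -> 0 <= y' <= 1 -> x' + y' = x + y ->
  (x' * y' - x * y) * (pb_pmf l' k - pb_pmf l' (S k)) <= 0 /\
  ((x' * y' - x * y) * (pb_pmf l' k - pb_pmf l' (S k)) = 0 -> x' * y' <= x * y).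
Proof.
  intros [Hunit Hmax] HP Hx' Hy' Hs.
  assert (Hu := unit_list_perm _ _ HP Hunit). inversion_clear Hu as [|? ? _ Hu'].
  inversion_clear Hu' as [|? ? _ Hul].
  assert (HS := lsum_perm _ _ HP).
  assert (HQ := lsum_perm _ _ (Permutation_map Rsqr HP)).
  destruct (Hmax (x' :: y' :: l')) as [H1 H2].
  - now rewrite (Permutation_length HP).
  - repeat (constructor; auto).
  - rewrite HS. simpl. lra.
  - rewrite (pb_tail_perm _ _ _ HP), !pb_tail_cons2, Hs in H1, H2.
    split; [lra|]. intros H3. lapply H2; [|lra]. rewrite HQ. unfold Rsqr. simpl. nra.
Qed.

(** Averaging [x] and [y] strictly raises their product, so a positive slope contradicts maximality
    and a zero slope the tie-break. Once the slope is negative, spreading the two apart would raise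
    the tail, so one of them must be blocked at an endpoint. *)
Lemma pb_maximiser_pair (k : nat) (l : list R) (x y : R) (l' : list R) :
  pb_maximiser (S (S k)) l -> Permutation l (x :: y :: l') -> x < y ->
  pb_pmf l' k < pb_pmf l' (S k) /\ (x = 0 \/ y = 1).
Proof.
  intros Hm HP Hxy.
  assert (Hu := unit_list_perm _ _ HP (proj1 Hm)). inversion_clear Hu as [|? ? Hx Hu'].
  inversion_clear Hu' as [|? ? Hy _].
  assert (HD : pb_pmf l' k < pb_pmf l' (S k)).
  { destruct (pb_maximiser_transfer k l x y ((x + y) / 2) ((x + y) / 2) l' Hm HP) as [H1 H2];
      try lra.
    assert (0 < (x + y) / 2 * ((x + y) / 2) - x * y) by nra.
    apply Rnot_le_lt. intros Hc.
    assert ((x + y) / 2 * ((x + y) / 2) <= x * y); [|lra]. apply H2. nra. }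
  split; [exact HD|].
  destruct (Req_dec x 0) as [|Hx0]; [now left|].
  destruct (Req_dec y 1) as [|Hy1]; [now right|exfalso].
  (* The largest spread that keeps both entries in [[0, 1]]. *)
  set (e := Rmin x (1 - y)).
  assert (He : 0 < e <= x /\ e <= 1 - y).
  { unfold e. split; [split; [apply Rmin_pos; lra|apply Rmin_l]|apply Rmin_r]. }
  destruct (pb_maximiser_transfer k l x y (x - e) (y + e) l' Hm HP) as [H1 _]; try lra.
  assert ((x - e) * (y + e) - x * y < 0) by nra. nra.
Qed.

Lemma pb_maximiser_three_valued (k : nat) (l : list R) :
  pb_maximiser (S (S k)) l ->
  exists a, 0 < a < 1 /\ forall x, In x l -> x = 0 \/ x = a \/ x = 1.
Proof.
  intros Hm.
  assert (Hin : forall x, In x l -> 0 <= x <= 1) by (apply Forall_forall, Hm).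
  destruct (classic (exists a, In a l /\ 0 < a < 1)) as [(a & Ha & Ha01)|Hn].
  - exists a. split; [exact Ha01|]. intros x Hx. specialize (Hin x Hx).
    destruct (Rtotal_order x a) as [H|[H|H]]; [|auto|].
    + destruct (Permutation_pair_in l x a) as [l' HP]; auto; [lra|].
      destruct (pb_maximiser_pair k l x a l' Hm HP H) as [_ [|]]; [auto|lra].
    + destruct (Permutation_pair_in l a x) as [l' HP]; auto; [lra|].
      destruct (pb_maximiser_pair k l a x l' Hm HP H) as [_ [|]]; [lra|auto].
  (* Without an interior entry, any value in [(0, 1)] can stand for [a]. *)
  - exists (1 / 2). split; [lra|]. intros x Hx. specialize (Hin x Hx).
    destruct (Req_dec x 0); [auto|]. destruct (Req_dec x 1); [auto|].
    exfalso. apply Hn. exists x. split; [exact Hx|lra].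
Qed.

(** For entries [x < y], the negative slope and [pb_pmf_increase] on the other trials give
    [k + 1 < lsum l - x - y + a]. Since [y] is [a] or 1, [x + y >= a], so [k + 1 < lsum l], a
    contradiction. *)
Lemma pb_maximiser_constant (k : nat) (l : list R) (x y : R) :
  pb_maximiser (S (S k)) l -> lsum l <= INR k + 1 -> In x l -> In y l -> x = y.
Proof.
  intros Hm Hk.
  enough (Hlt : forall x y, In x l -> In y l -> ~ x < y).
  { intros Hx Hy. destruct (Rtotal_order x y) as [H|[H|H]]; [|exact H|];
      exfalso; [apply (Hlt x y)|apply (Hlt y x)]; assumption. }
  clear x y. intros x y Hx Hy Hxy.
  destruct (pb_maximiser_three_valued k l Hm) as (a & Ha & H3).
  destruct (Permutation_pair_in l x y) as [l' HP]; auto; [lra|].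
  destruct (pb_maximiser_pair k l x y l' Hm HP Hxy) as [HD _].
  apply (pb_pmf_increase a) in HD; [|exact Ha|].
  - assert (HS := lsum_perm _ _ HP). rewrite !lsum_cons in HS.
    destruct (H3 x Hx) as [->|[->| ->]]; destruct (H3 y Hy) as [->|[->| ->]]; lra.
  - intros z Hz. apply H3. apply (Permutation_in _ (Permutation_sym HP)).
    now right; right.
Qed.

(* Hoeffding's extremal property of the binomial distribution. *)
Lemma pb_tail_le_binomial (l : list R) (k : nat) (p : R) :
  unit_list l -> lsum l = INR (length l) * p ->
  lsum l <= INR k + 1 ->
  pb_tail l (S (S k)) <= pb_tail (repeat p (length l)) (S (S k)).
Proof.
  intros Hu Hs Hk.
  destruct (pb_maximiser_exists (length l) (S (S k)) (lsum l)) as (l1 & Hlen1 & Hs1 & Hm);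
    [now exists l|].
  destruct (proj2 Hm l) as [Hle _]; try congruence.
  (* A constant maximiser with this sum can only have the common value [p]. *)
  replace (repeat p (length l)) with l1; [exact Hle|].
  assert (Hc : forall x y, In x l1 -> In y l1 -> x = y).
  { intros x y. apply (pb_maximiser_constant k l1 x y Hm). lra. }
  rewrite Hs, <- Hlen1 in Hs1. rewrite <- Hlen1. clear - Hc Hs1.
  destruct l1 as [|c l1]; [reflexivity|].
  assert (E : c :: l1 = repeat c (length (c :: l1))).
  { apply Forall_eq_repeat, Forall_forall. intros y Hy. apply Hc; [now left|exact Hy]. }
  rewrite E at 1. f_equal.
  rewrite E, lsum_repeat, repeat_length in Hs1.
  apply Rmult_eq_reg_l in Hs1; [exact Hs1|apply not_0_INR; discriminate].
Qed.

(** * Finite sums, reflection, and the first moment *)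

Fixpoint rsum (F : nat -> R) (n : nat) : R :=
  match n with
  | O => 0
  | S n' => rsum F n' + F n'
  end.

Lemma rsum_ext (F G : nat -> R) (n : nat) :
  (forall i, (i < n)%nat -> F i = G i) -> rsum F n = rsum G n.
Proof.
  induction n as [|n IH]; intros H; simpl; [reflexivity|].
  rewrite IH, H by (try intros; try apply H; lia). reflexivity.
Qed.

Lemma rsum_le (F G : nat -> R) (n : nat) :
  (forall i, (i < n)%nat -> F i <= G i) -> rsum F n <= rsum G n.
Proof.
  induction n as [|n IH]; intros H; simpl; [lra|].
  apply Rplus_le_compat; [apply IH; intros; apply H; lia|apply H; lia].
Qed.

Lemma rsum_scal (c : R) (F : nat -> R) (n : nat) :
  rsum (fun i => c * F i) n = c * rsum F n.
Proof. induction n as [|n IH]; simpl; [ring|rewrite IH; ring]. Qed.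

Lemma rsum_Sl (F : nat -> R) (n : nat) :
  rsum F (S n) = F 0%nat + rsum (fun i => F (S i)) n.
Proof. induction n as [|n IH]; [simpl; ring|]. simpl in *. rewrite IH. ring. Qed.

Lemma rsum_eventually_0 (F : nat -> R) (n N : nat) :
  (n <= N)%nat -> (forall i, (n <= i)%nat -> F i = 0) -> rsum F N = rsum F n.
Proof.
  intros H HF. induction H as [|N H IH]; [reflexivity|].
  simpl. rewrite IH, HF by exact H. ring.
Qed.

Lemma rsum_telescope (t : nat -> R) (n : nat) :
  rsum (fun j => t j - t (S j)) n = t 0%nat - t n.
Proof. induction n as [|n IH]; simpl; [ring|rewrite IH; ring]. Qed.

Lemma rsum_reflect_split (F : nat -> R) (m L : nat) :
  rsum F (m + L) = rsum (fun i => F (m + i)%nat) L + rsum (fun i => F (m - 1 - i)%nat) m.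
Proof.
  replace (rsum (fun i => F (m - 1 - i)%nat) m) with (rsum F m).
  - induction L as [|L IH].
    + rewrite Nat.add_0_r. simpl. ring.
    + rewrite Nat.add_succ_r. simpl. rewrite IH. ring.
  - induction m as [|m IH]; [reflexivity|].
    change (rsum F (S m)) with (rsum F m + F m).
    rewrite IH, rsum_Sl, Rplus_comm. f_equal; [f_equal; lia|].
    apply rsum_ext. intros i Hi. f_equal. lia.
Qed.

(** Folding about [m - 1/2]. The guard removes [i >= m], where the truncated [m - 1 - i] is 0 and
    not a mirror index. *)
Lemma rsum_reflect (F : nat -> R) (m L : nat) :
  (m <= L)%nat ->
  rsum F (m + L)
  = rsum (fun i => F (m + i)%nat + (if (i <? m)%nat then F (m - 1 - i)%nat else 0)) L.
Proof.
  intros HmL. rewrite rsum_reflect_split.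
  replace (rsum (fun i => F (m - 1 - i)%nat) m)
    with (rsum (fun i => if (i <? m)%nat then F (m - 1 - i)%nat else 0) L).
  - clear HmL. induction L as [|L IH]; simpl; [ring|]. rewrite <- IH. ring.
  - rewrite (rsum_eventually_0 _ m L HmL).
    + apply rsum_ext. intros i Hi. apply Nat.ltb_lt in Hi. now rewrite Hi.
    + intros i Hi. apply Nat.ltb_ge in Hi. now rewrite Hi.
Qed.

(** The tail-sum formula for the mean: a success shifts the tails by one index and so adds
    [pb_tail l 0 = 1]. *)
Lemma rsum_pb_tail (l : list R) (N : nat) :
  (length l <= N)%nat -> rsum (fun j => pb_tail l (S j)) N = lsum l.
Proof.
  revert N; induction l as [|x l IH]; intros N HN.
  - apply (rsum_eventually_0 _ 0); [lia|reflexivity].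
  - destruct N as [|N]; simpl in HN; [lia|].
    rewrite lsum_cons.
    transitivity (x * rsum (fun j => pb_tail l j) (S N)
                  + (1 - x) * rsum (fun j => pb_tail l (S j)) (S N)).
    + rewrite <- !rsum_scal. generalize (S N). induction n as [|n IHn]; cbn [rsum]; [ring|].
      rewrite IHn, pb_tail_cons. ring.
    + rewrite rsum_Sl, !IH, pb_tail_0 by lia. ring.
Qed.

Lemma pb_moment (l : list R) (c : R) (N : nat) :
  (length l < N)%nat -> rsum (fun j => (INR j + c) * pb_pmf l j) N = lsum l + c.
Proof.
  intros HN.
  (* Summation by parts; the boundary term vanishes beyond the number of trials. *)
  assert (E : forall M, rsum (fun j => (INR j + c) * pb_pmf l j) (S M)
    = c + rsum (fun j => pb_tail l (S j)) M - (INR M + c) * pb_tail l (S M)).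
  { induction M as [|M IH].
    - simpl. unfold pb_pmf. rewrite pb_tail_0. ring.
    - change (rsum (fun j => (INR j + c) * pb_pmf l j) (S M)
              + (INR (S M) + c) * pb_pmf l (S M)
              = c + (rsum (fun j => pb_tail l (S j)) M + pb_tail l (S M))
                - (INR (S M) + c) * pb_tail l (S (S M))).
      rewrite IH, S_INR. unfold pb_pmf. ring. }
  destruct N as [|N]; [lia|].
  rewrite E, rsum_pb_tail, pb_tail_gt_length by lia. ring.
Qed.

(** * The median of the binomial distribution *)

Lemma least_below (P : nat -> Prop) (N : nat) :
  (forall i, (i < N)%nat -> ~ P i) \/
  exists i, (i < N)%nat /\ P i /\ forall j, (j < i)%nat -> ~ P j.
Proof.
  induction N as [|N [H|(i & Hi & HP)]].
  - left. intros; lia.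
  - destruct (classic (P N)) as [HN|HN].
    + right. exists N. auto.
    + left. intros i Hi. destruct (Nat.eq_dec i N) as [->|]; [exact HN|apply H; lia].
  - right. exists i. split; [lia|exact HP].
Qed.

(** The weight [i + 1/2] is at most [i1 + 1/2] where [e] is nonnegative and at least that where [e]
    is nonpositive, so the weighted sum is at most [i1 + 1/2] times the plain one. *)
Lemma rsum_single_crossing (e : nat -> R) (i1 L : nat) :
  (forall i, (i < i1)%nat -> 0 <= e i) -> (forall i, (i1 <= i)%nat -> e i <= 0) ->
  0 <= rsum (fun i => (INR i + 1 / 2) * e i) L -> 0 <= rsum e L.
Proof.
  intros Hpos Hneg H.
  assert (H1 : rsum (fun i => (INR i + 1 / 2) * e i) L
               <= rsum (fun i => (INR i1 + 1 / 2) * e i) L).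
  { apply rsum_le. intros i _. destruct (Nat.lt_ge_cases i i1) as [Hi|Hi].
    - specialize (Hpos i Hi). apply lt_INR in Hi. nra.
    - specialize (Hneg i Hi). apply le_INR in Hi. nra. }
  rewrite rsum_scal in H1. pose proof (pos_INR i1). nra.
Qed.

(** One step outwards on both sides of the reflection: [X], [X'] are weights above the centre, [Y],
    [Y'] their mirrors. Over a common denominator, the sign of one quadratic in [v] decides which
    side gains. *)
Lemma ratio_step (p u m v X X' Y Y' : R) :
  0 < p < 1 -> 0 < u + v -> 0 < v < m -> 0 <= X -> 0 <= Y ->
  (1 - p) * (m + v) * X' = p * (u - v) * X ->
  (1 - p) * (m - v) * Y = p * (u + v) * Y' ->
  (0 <= p ^ 2 * (u ^ 2 - v ^ 2) - (1 - p) ^ 2 * (m ^ 2 - v ^ 2) -> Y <= X -> Y' <= X') /\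
  (p ^ 2 * (u ^ 2 - v ^ 2) - (1 - p) ^ 2 * (m ^ 2 - v ^ 2) <= 0 -> X <= Y -> X' <= Y').
Proof.
  intros Hp Hu Hv HX HY E1 E2.
  set (c := (1 - p) * (m + v) * (p * (u + v))).
  assert (Hc : 0 < c) by (unfold c; repeat apply Rmult_lt_0_compat; lra).
  assert (F1 : c * X' = p ^ 2 * (u ^ 2 - v ^ 2) * X).
  { transitivity (p * (u + v) * ((1 - p) * (m + v) * X')); [unfold c; ring|].
    rewrite E1. ring. }
  assert (F2 : c * Y' = (1 - p) ^ 2 * (m ^ 2 - v ^ 2) * Y).
  { transitivity ((1 - p) * (m + v) * (p * (u + v) * Y')); [unfold c; ring|].
    rewrite <- E2. ring. }
  assert (HB : 0 <= (1 - p) ^ 2 * (m ^ 2 - v ^ 2)).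
  { apply Rmult_le_pos; [apply pow2_ge_0|nra]. }
  set (A := p ^ 2 * (u ^ 2 - v ^ 2)) in *.
  set (B := (1 - p) ^ 2 * (m ^ 2 - v ^ 2)) in *.
  split; intros HA HXY; apply Rmult_le_reg_l with (1 := Hc); rewrite F1, F2; nra.
Qed.

(* The weights at [m + i] and at [m - 1 - i] (reflection about [m - 1/2]) are
   compared: their difference changes sign at most once, from plus to minus. *)
Lemma binomial_median_open (p : R) (n m : nat) :
  0 < p < 1 -> (1 <= m <= n)%nat -> INR m <= INR n * p ->
  1 / 2 <= pb_tail (repeat p n) m.
Proof.
  intros Hp Hm Hmp.
  set (l := repeat p n). set (b := pb_pmf l).
  assert (Hlen : length l = n) by apply repeat_length.
  assert (Hul : unit_list l) by (apply unit_list_repeat; lra).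
  assert (Hb : forall j, 0 <= b j) by (intros; now apply pb_pmf_ge0).
  assert (Hrec : forall j, (1 - p) * (INR j + 1) * b (S j) = p * (INR n - INR j) * b j)
    by (intros; now apply binomial_pmf_rec).
  set (e := fun i => b (m + i)%nat - (if (i <? m)%nat then b (m - 1 - i)%nat else 0)).
  assert (Hmn : INR m <= INR n) by (apply le_INR; lia).
  assert (Hm1 : 1 <= INR m) by (apply (le_INR 1); lia).
  set (u := INR n - INR m + 1).
  assert (Hstep : forall i, (S i < m)%nat ->
    let v := INR i + 1 in
    (0 <= p ^ 2 * (u ^ 2 - v ^ 2) - (1 - p) ^ 2 * (INR m ^ 2 - v ^ 2) ->
       0 <= e i -> 0 <= e (S i)) /\
    (p ^ 2 * (u ^ 2 - v ^ 2) - (1 - p) ^ 2 * (INR m ^ 2 - v ^ 2) <= 0 ->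
       e i <= 0 -> e (S i) <= 0)).
  { intros i Hi v. unfold e.
    rewrite (proj2 (Nat.ltb_lt i m)), (proj2 (Nat.ltb_lt (S i) m)) by lia.
    assert (HiR : INR i + 1 < INR m) by (rewrite <- S_INR; now apply lt_INR).
    pose proof (pos_INR i).
    pose proof (Hrec (m + i)%nat) as E1. pose proof (Hrec (m - 1 - S i)%nat) as E2.
    replace (S (m - 1 - S i)) with (m - 1 - i)%nat in E2 by lia.
    replace (S (m + i)) with (m + S i)%nat in E1 by lia.
    replace (INR (m - 1 - S i)) with (INR m - 1 - v) in E2
      by (rewrite !minus_INR, !S_INR by lia; unfold v; simpl; ring).
    rewrite plus_INR in E1.
    destruct (ratio_step p u (INR m) v (b (m + i)%nat) (b (m + S i)%nat)
                (b (m - 1 - i)%nat) (b (m - 1 - S i)%nat)) as [S1 S2];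
      try (unfold u, v; lra); try apply Hb.
    { replace (INR m - v) with (INR m - 1 - v + 1) by ring. rewrite E2.
      unfold u. ring. }
    split; intros HA He.
    - specialize (S1 HA). lra.
    - specialize (S2 HA). lra. }
  assert (He0 : 0 <= e 0%nat).
  { unfold e. rewrite (proj2 (Nat.ltb_lt 0 m)) by lia.
    pose proof (Hrec (m - 1)%nat) as E.
    replace (S (m - 1)) with m in E by lia.
    rewrite minus_INR in E by lia. simpl INR in E.
    rewrite Nat.add_0_r. replace (m - 1 - 0)%nat with (m - 1)%nat by lia.
    pose proof (Hb (m - 1)%nat).
    assert (Hc : 0 < (1 - p) * INR m) by nra.
    enough (b (m - 1)%nat <= b m) by lra.
    apply Rmult_le_reg_l with (1 := Hc). nra. }
  (* This is [m <= n p] rewritten as [(1 - p) m <= p u] and squared: the quadratic of [ratio_step]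
     is nonnegative at [v = 0]. *)
  assert (Hpu : (1 - p) ^ 2 * INR m ^ 2 <= p ^ 2 * u ^ 2).
  { rewrite <- !Rpow_mult_distr. apply pow_incr. unfold u. split; nra. }
  assert (Hlate : forall i, (m <= i)%nat -> e i = b (m + i)%nat).
  { intros i Hi. unfold e. rewrite (proj2 (Nat.ltb_ge i m) Hi). ring. }
  (* The sum of [e] is the mass at or above [m] minus the mass below, so its nonnegativity is the
     claim. *)
  assert (Hpmf : rsum e n = pb_tail l m - (1 - pb_tail l m)).
  { unfold e.
    transitivity (rsum (fun j => if (j <? m)%nat then - b j else b j) (m + n)).
    - rewrite rsum_reflect by lia. apply rsum_ext. intros i _.
      rewrite (proj2 (Nat.ltb_ge (m + i) m)) by lia.
      destruct (i <? m)%nat eqn:Hi; [|ring]. apply Nat.ltb_lt in Hi.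
      rewrite (proj2 (Nat.ltb_lt (m - 1 - i) m)) by lia. ring.
    - assert (Ex : forall L, rsum (fun j => if (j <? m)%nat then - b j else b j) (m + L)
        = pb_tail l m - pb_tail l (m + L) - (1 - pb_tail l m)).
      { induction L as [|L IH].
        - rewrite Nat.add_0_r.
          rewrite (rsum_ext _ (fun j => -1 * (pb_tail l j - pb_tail l (S j)))).
          + rewrite rsum_scal, rsum_telescope, pb_tail_0. ring.
          + intros i Hi. rewrite (proj2 (Nat.ltb_lt i m)) by lia. unfold b, pb_pmf. ring.
        - rewrite Nat.add_succ_r. simpl rsum. rewrite IH.
          rewrite (proj2 (Nat.ltb_ge (m + L) m)) by lia. unfold b, pb_pmf. ring. }
      rewrite Ex, (pb_tail_gt_length l (m + n)) by lia. ring. }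
  (* After reflection, [j - (m - 1/2)] becomes plus or minus [i + 1/2]; the sum is the mean minus
     [m - 1/2]. *)
  assert (Hmom : 0 <= rsum (fun i => (INR i + 1 / 2) * e i) n).
  { replace (rsum (fun i => (INR i + 1 / 2) * e i) n)
      with (rsum (fun j => (INR j + (1 / 2 - INR m)) * pb_pmf l j) (m + n)).
    - rewrite pb_moment by lia. unfold l. rewrite lsum_repeat. lra.
    - rewrite rsum_reflect by lia. apply rsum_ext. intros i _. unfold e, b.
      rewrite plus_INR. destruct (i <? m)%nat eqn:Hi; [|ring].
      apply Nat.ltb_lt in Hi. rewrite !minus_INR by lia. simpl INR. field. }
  enough (0 <= rsum e n) by lra.
  destruct (least_below (fun i => e i < 0) m) as [Hall|(i1 & Hi1 & Hneg & Hpos)].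
  - apply (Rle_trans _ (rsum (fun _ => 0 * 0) n)).
    + rewrite rsum_scal. lra.
    + apply rsum_le. intros i _. rewrite Rmult_0_l.
      destruct (Nat.lt_ge_cases i m) as [Hi|Hi].
      * apply Rnot_lt_le, Hall, Hi.
      * rewrite Hlate by exact Hi. apply Hb.
  - destruct i1 as [|i0]; [lra|].
    destruct (Hstep i0 Hi1) as [Hs _].
    set (v0 := INR i0 + 1) in *.
    assert (HA : p ^ 2 * (u ^ 2 - v0 ^ 2) - (1 - p) ^ 2 * (INR m ^ 2 - v0 ^ 2) < 0).
    { apply Rnot_le_lt. intros HA.
      assert (0 <= e i0) by (apply Rnot_lt_le, Hpos; lia). specialize (Hs HA). lra. }
    assert (Hv0 : 1 <= v0) by (unfold v0; pose proof (pos_INR i0); lra).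
    assert (Hv0m : v0 < INR m) by (unfold v0; rewrite <- S_INR; now apply lt_INR).
    (* The quadratic goes from nonnegative at 0 to negative at [v0], so its coefficient
       [(1 - p)^2 - p^2] is negative and it stays negative beyond [v0]. *)
    assert (Hphalf : (1 - p) ^ 2 < p ^ 2).
    { apply Rnot_le_lt. intros Hc. assert (0 <= v0 ^ 2) by apply pow2_ge_0. nra. }
    (* This gives [n < 2 m - 1], so for [i >= m] the index [m + i] exceeds [n] and the unpaired
       weights vanish. *)
    assert (Hum : u < INR m).
    { apply Rnot_le_lt. intros Hc.
      assert (INR m ^ 2 <= u ^ 2) by (apply pow_incr; lra).
      assert (0 < INR m ^ 2 - v0 ^ 2) by nra.
      assert (0 <= p ^ 2) by apply pow2_ge_0. nra. }
    apply (rsum_single_crossing e (S i0)); [| |exact Hmom].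
    + intros i Hi. apply Rnot_lt_le, Hpos, Hi.
    + assert (Hdecr : forall d, (S i0 + d < m)%nat -> e (S i0 + d)%nat <= 0).
      { induction d as [|d IH]; intros Hd.
        - rewrite Nat.add_0_r. lra.
        - rewrite Nat.add_succ_r.
          destruct (Hstep (S i0 + d)%nat) as [_ Hs2]; [lia|]. apply Hs2; [|apply IH; lia].
          set (v := INR (S i0 + d) + 1).
          assert (v0 <= v).
          { unfold v0, v. assert (INR i0 <= INR (S i0 + d)) by (apply le_INR; lia). lra. }
          assert (v0 ^ 2 <= v ^ 2) by (apply pow_incr; lra). nra. }
      intros i Hi. destruct (Nat.lt_ge_cases i m) as [Him|Him].
      * replace i with (S i0 + (i - S i0))%nat in * by lia. apply Hdecr. exact Him.
      * rewrite Hlate by exact Him. unfold b. rewrite pb_pmf_gt_length; [lra|].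
        rewrite Hlen. apply INR_lt. rewrite plus_INR. apply le_INR in Him.
        unfold u in Hum. lra.
Qed.

Lemma pb_tail_repeat_1 (n k : nat) : (k <= n)%nat -> pb_tail (repeat 1 n) k = 1.
Proof.
  revert k; induction n as [|n IH]; intros [|k] H; try reflexivity; [lia|].
  simpl repeat. rewrite pb_tail_cons, IH by lia. ring.
Qed.

Lemma binomial_median (p : R) (n m : nat) :
  0 <= p <= 1 -> (1 <= m <= n)%nat -> INR m <= INR n * p ->
  1 / 2 <= pb_tail (repeat p n) m.
Proof.
  intros Hp Hm Hmp.
  assert (Hm1 : 1 <= INR m) by (apply (le_INR 1); lia).
  destruct (Req_dec p 0) as [->|H0]; [lra|].
  destruct (Req_dec p 1) as [->|H1]; [rewrite pb_tail_repeat_1; [lra|lia]|].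
  apply binomial_median_open; auto; lra.
Qed.

(** * Binomial tails as regularized incomplete Beta functions *)

(** The constant is the binomial coefficient; it is kept abstract because normalising the Beta
    integral cancels it. *)
Lemma binomial_pmf_closed_form (n j : nat) :
  (j <= n)%nat ->
  exists c, 0 < c /\ forall x, pb_pmf (repeat x n) j = c * (x ^ j * (1 - x) ^ (n - j)).
Proof.
  revert j; induction n as [|n IH]; intros j Hj.
  - exists 1. split; [lra|]. intros x. replace j with 0%nat by lia. unfold pb_pmf. simpl. ring.
  - destruct j as [|j].
    + destruct (IH 0%nat) as (c & Hc & E); [lia|]. exists c. split; [exact Hc|].
      intros x. simpl repeat. rewrite pb_pmf_cons_0, E, !Nat.sub_0_r. simpl. ring.
    + destruct (IH j) as (c & Hc & E); [lia|].
      destruct (Nat.eq_dec j n) as [->|Hjn].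
      * exists c. split; [exact Hc|]. intros x. simpl repeat.
        rewrite pb_pmf_cons_S, E, pb_pmf_gt_length by (rewrite repeat_length; lia).
        rewrite !Nat.sub_diag. simpl. ring.
      * destruct (IH (S j)) as (c' & Hc' & E'); [lia|].
        exists (c + c'). split; [lra|]. intros x. simpl repeat.
        rewrite pb_pmf_cons_S, E, E'.
        replace (S n - S j)%nat with (n - j)%nat by lia.
        replace (n - j)%nat with (S (n - S j)) by lia. simpl. ring.
Qed.

Lemma binomial_tail_derive (n m : nat) (x : R) :
  derivable_pt_lim (fun y => pb_tail (repeat y (S n)) (S m)) x
    (INR (S n) * pb_pmf (repeat x n) m).
Proof.
  revert m; induction n as [|n IH]; intros m.
  - destruct m as [|m]; apply is_derive_Reals; unfold pb_pmf; simpl; auto_derive; auto; ring.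
  (* Conditioning on one trial also calls for the tail at [m], which is constant when [m = 0]. *)
  - assert (H0 : derivable_pt_lim (fun y => pb_tail (repeat y (S n)) m) x
        (INR (S n) * match m with O => 0 | S m' => pb_pmf (repeat x n) m' end)).
    { destruct m as [|m]; [|apply IH].
      rewrite Rmult_0_r. apply (derivable_pt_lim_const 1). }
    apply (derivable_pt_lim_ext
      (fun y => y * pb_tail (repeat y (S n)) m + (1 - y) * pb_tail (repeat y (S n)) (S m)));
      [reflexivity|].
    assert (H1 := derivable_pt_lim_mult _ _ x _ _ (derivable_pt_lim_id x) H0).
    assert (H2 := derivable_pt_lim_mult _ _ x _ _
      (derivable_pt_lim_minus _ _ x _ _ (derivable_pt_lim_const 1 x) (derivable_pt_lim_id x))
      (IH m)).
    assert (H3 := derivable_pt_lim_plus _ _ x _ _ H1 H2).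
    eapply eq_ind with (P := derivable_pt_lim _ x); [exact H3|].
    unfold minus_fct, fct_cte, id. rewrite (S_INR (S n)).
    destruct m as [|m].
    + simpl (repeat x (S n)). rewrite pb_pmf_cons_0. unfold pb_pmf.
      rewrite !pb_tail_cons, !pb_tail_0. ring.
    + simpl (repeat x (S n)). rewrite pb_pmf_cons_S. unfold pb_pmf.
      rewrite !pb_tail_cons. ring.
Qed.

Lemma binomial_tail_derive_beta (n m : nat) :
  (1 <= m <= n)%nat ->
  exists c, 0 < c /\ forall x,
    derivable_pt_lim (fun y => pb_tail (repeat y n) m) x
      (c * beta_kernel m (n - m + 1) x).
Proof.
  intros Hm. destruct n as [|n]; [lia|]. destruct m as [|m]; [lia|].
  destruct (binomial_pmf_closed_form n m) as (c & Hc & E); [lia|].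
  exists (INR (S n) * c). split.
  - apply Rmult_lt_0_compat; [apply lt_0_INR; lia|exact Hc].
  - intros x. unfold beta_kernel.
    replace (S m - 1)%nat with m by lia.
    replace (S n - S m + 1 - 1)%nat with (n - m)%nat by lia.
    rewrite Rmult_assoc, <- E. apply binomial_tail_derive.
Qed.

Lemma beta_kernel_continuous (a b : nat) (x : R) : continuous (beta_kernel a b) x.
Proof.
  apply (ex_derive_continuous (beta_kernel a b)). unfold beta_kernel. auto_derive. auto.
Qed.

Lemma pb_tail_repeat_0 (n k : nat) : pb_tail (repeat 0 n) (S k) = 0.
Proof.
  induction n as [|n IH]; [reflexivity|].
  simpl repeat. rewrite pb_tail_cons, IH. ring.
Qed.

(** The tail vanishes at 0 and its derivative is [c] times the Beta kernel, so [c] times the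
    integral up to [y] is the tail at [y]. At [y = 1] this is 1, and [c] drops out of the
    quotient. *)
Lemma is_incbeta_binomial_tail (n m : nat) (x v : R) :
  (1 <= m <= n)%nat -> is_incbeta m (n - m + 1) x v -> v = pb_tail (repeat x n) m.
Proof.
  intros Hm (p1 & p2 & ->).
  destruct (binomial_tail_derive_beta n m Hm) as (c & Hc & HD).
  assert (HI : forall y (pr : Riemann_integrable (beta_kernel m (n - m + 1)) 0 y),
    c * RiemannInt pr = pb_tail (repeat y n) m).
  { intros y pr. rewrite <- RInt_Reals.
    assert (H : is_RInt (fun t => c * beta_kernel m (n - m + 1) t) 0 y
              (minus (pb_tail (repeat y n) m) (pb_tail (repeat 0 n) m))).
    { apply (is_RInt_derive (fun t => pb_tail (repeat t n) m)).
      - intros t _. apply is_derive_Reals, HD.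
      - intros t _. apply (continuous_scal_r (V := R_NormedModule) c), beta_kernel_continuous. }
    apply (is_RInt_unique (V := R_CompleteNormedModule)) in H.
    assert (H' := RInt_scal (V := R_CompleteNormedModule) _ 0 y c (ex_RInt_Reals_1 _ _ _ pr)).
    destruct m as [|m]; [lia|]. rewrite pb_tail_repeat_0 in H.
    transitivity (RInt (fun t => c * beta_kernel (S m) (n - S m + 1) t) 0 y);
      [symmetry; exact H'|].
    rewrite H. unfold minus, plus, opp. simpl. ring. }
  assert (H1 := HI x p1). assert (H2 := HI 1 p2). rewrite pb_tail_repeat_1 in H2 by lia.
  rewrite <- H1. field_simplify_eq; [|intros E; rewrite E in H2; lra].
  transitivity (RiemannInt p1 * (c * RiemannInt p2)); [rewrite H2; ring|ring].
Qed.

Lemma binomial_tail_lt (n m : nat) (x y : R) :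
  (1 <= m <= n)%nat -> 0 <= x -> x < y -> y <= 1 ->
  pb_tail (repeat x n) m < pb_tail (repeat y n) m.
Proof.
  intros Hm Hx Hxy Hy.
  destruct (binomial_tail_derive_beta n m Hm) as (c & Hc & HD).
  destruct (MVT_cor2 (fun t => pb_tail (repeat t n) m) _ x y Hxy (fun t _ => HD t))
    as (z & Hz & Hz').
  enough (0 < c * beta_kernel m (n - m + 1) z * (y - x)) by lra.
  unfold beta_kernel.
  repeat apply Rmult_lt_0_compat; try apply pow_lt; lra.
Qed.

(** * From Boolean vectors to tails, and the coverage bound *)

Lemma lsum_app (l l' : list R) : lsum (l ++ l') = lsum l + lsum l'.
Proof. induction l as [|x l IH]; [simpl; ring|]. simpl app. rewrite !lsum_cons, IH. ring. Qed.

Lemma lsum_map_scal {A : Type} (c : R) (f : A -> R) (l : list A) :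
  lsum (map (fun t => c * f t) l) = c * lsum (map f l).
Proof.
  induction l as [|x l IH]; [simpl; ring|]. rewrite !map_cons, !lsum_cons, IH. ring.
Qed.

Lemma lsum_map_plus {A : Type} (f g : A -> R) (l : list A) :
  lsum (map (fun t => f t + g t) l) = lsum (map f l) + lsum (map g l).
Proof.
  induction l as [|x l IH]; [simpl; ring|]. rewrite !map_cons, !lsum_cons, IH. ring.
Qed.

Lemma lsum_map_le {A : Type} (f g : A -> R) (l : list A) :
  (forall t, In t l -> f t <= g t) -> lsum (map f l) <= lsum (map g l).
Proof.
  induction l as [|x l IH]; intros H; [apply Rle_refl|].
  rewrite !map_cons, !lsum_cons.
  apply Rplus_le_compat; [apply H; now left|apply IH; intros; apply H; now right].
Qed.

Lemma bern_tail (q : nat -> R) (n i k : nat) :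
  lsum (map (fun t => if (k <=? nsucc t)%nat then bern_weight q i t else 0) (bvecs n))
  = pb_tail (map q (seq i n)) k.
Proof.
  revert i k; induction n as [|n IH]; intros i k.
  - destruct k; simpl; ring.
  - simpl bvecs. rewrite map_app, lsum_app, !map_map. simpl seq. rewrite map_cons.
    (* A success leaves the threshold [pred k], which stays 0 at [k = 0]. *)
    rewrite (map_ext
      (fun t => if (k <=? nsucc (true :: t))%nat then bern_weight q i (true :: t) else 0)
      (fun t => q i * if (pred k <=? nsucc t)%nat then bern_weight q (S i) t else 0)).
    2:{ intros t. destruct k as [|k]; simpl; [ring|].
        change (length (filter (fun b : bool => b) t)) with (nsucc t).
        destruct (k <=? nsucc t)%nat; ring. }
    rewrite (map_ext
      (fun t => if (k <=? nsucc (false :: t))%nat then bern_weight q i (false :: t) else 0)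
      (fun t => (1 - q i) * if (k <=? nsucc t)%nat then bern_weight q (S i) t else 0)).
    2:{ intros t. change (nsucc (false :: t)) with (nsucc t). simpl.
        destruct (k <=? nsucc t)%nat; ring. }
    rewrite !lsum_map_scal, !IH. destruct k as [|k]; [|reflexivity].
    simpl pred. rewrite !pb_tail_0. ring.
Qed.

Lemma nsucc_bvecs (n : nat) (t : list bool) : In t (bvecs n) -> (nsucc t <= n)%nat.
Proof.
  revert t; induction n as [|n IH]; intros t; simpl.
  - intros [<-|[]]. auto.
  - rewrite in_app_iff, !in_map_iff.
    intros [(t' & <- & Ht)|(t' & <- & Ht)]; apply IH in Ht; unfold nsucc in *; simpl; lia.
Qed.

Lemma bern_weight_ge0 (q : nat -> R) (n i : nat) (t : list bool) :
  (forall j, (i <= j < i + n)%nat -> 0 <= q j <= 1) -> In t (bvecs n) ->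
  0 <= bern_weight q i t.
Proof.
  revert i t; induction n as [|n IH]; intros i t Hq; simpl.
  - intros [<-|[]]. simpl. lra.
  - rewrite in_app_iff, !in_map_iff. assert (Hi := Hq i ltac:(lia)).
    intros [(t' & <- & Ht)|(t' & <- & Ht)]; simpl;
      (apply Rmult_le_pos; [lra|apply IH; [intros; apply Hq; lia|exact Ht]]).
Qed.

Lemma prob_sum_event_ge (n : nat) (q : nat -> R) (E : nat -> Prop)
  (Edec : forall k, {E k} + {~ E k}) (k0 : nat) :
  (forall i, (i < n)%nat -> 0 <= q i <= 1) ->
  (forall k, (k <= n)%nat -> (k < k0)%nat -> E k) ->
  prob_sum_event n q E Edec >= 1 - pb_tail (map q (seq 0 n)) k0.
Proof.
  intros Hq HE. apply Rle_ge.
  enough (1 <= prob_sum_event n q E Edec + pb_tail (map q (seq 0 n)) k0) by lra.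
  (* The total mass 1 is written as the tail at 0, so that all terms become sums over the same
     vectors and compare pointwise. *)
  rewrite <- (pb_tail_0 (map q (seq 0 n))), <- !bern_tail.
  unfold prob_sum_event. fold (lsum
    (map (fun t => if Edec (nsucc t) then bern_weight q 0 t else 0) (bvecs n))).
  rewrite <- lsum_map_plus. apply lsum_map_le. intros t Ht. simpl.
  assert (Hw : 0 <= bern_weight q 0 t).
  { apply (bern_weight_ge0 q n); [intros; apply Hq; lia|exact Ht]. }
  apply nsucc_bvecs in Ht.
  destruct (Edec (nsucc t)) as [He|He], (Nat.leb_spec k0 (nsucc t)) as [Hk|Hk]; try lra.
  exfalso. auto.
Qed.

Lemma lsum_qbar (n : nat) (q : nat -> R) :
  (1 <= n)%nat -> lsum (map q (seq 0 n)) = INR n * qbar n q.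
Proof.
  intros Hn. unfold qbar. field_simplify; [|apply not_0_INR; lia].
  destruct n as [|n]; [lia|]. replace (S n - 1)%nat with n by lia. clear Hn.
  induction n as [|n IH]; [simpl; ring|].
  rewrite seq_S, map_app, lsum_app, IH. simpl. ring.
Qed.

Lemma unit_list_lsum (l : list R) : unit_list l -> 0 <= lsum l <= INR (length l).
Proof.
  induction 1 as [|x l Hx _ IH]; [simpl; lra|].
  rewrite lsum_cons. simpl length. rewrite S_INR. lra.
Qed.

(* qhat k is the estimator as a function of k = n * Tbar (number of successes):
   qhat k = I^{-1}_alpha(k-1, n-k+2) for k >= 2, and 0 for k = 0, 1
   (k = 1: I^{-1}_alpha(0,b) := 0 by convention). *)
Theorem theorem2 (n : nat) (q : nat -> R) (alpha : R) (qhat : nat -> R) :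
  (1 <= n)%nat ->
  (forall i, (i < n)%nat -> 0 <= q i <= 1) ->
  0 <= alpha <= 1 / 2 ->
  qhat 0%nat = 0 ->
  qhat 1%nat = 0 ->
  (forall k, (2 <= k <= n)%nat ->
     is_incbeta_inv (k - 1) (n - k + 2) alpha (qhat k)) ->
  prob_sum_event n q (fun k => qhat k <= qbar n q)
    (fun k => Rle_dec (qhat k) (qbar n q)) >= 1 - alpha.
Proof.
  intros Hn Hq Halpha H0 H1 Hhat.
  set (p := qbar n q). set (l := map q (seq 0 n)).
  assert (Hlen : length l = n) by (unfold l; now rewrite length_map, length_seq).
  assert (Hu : unit_list l).
  { apply Forall_map, Forall_forall. intros i Hi. apply in_seq in Hi. apply Hq. lia. }
  assert (Hsum : lsum l = INR n * p) by now apply lsum_qbar.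
  assert (HnR : 1 <= INR n) by now apply (le_INR 1).
  assert (Hp : 0 <= p <= 1).
  { pose proof (unit_list_lsum l Hu) as Hl. rewrite Hsum, Hlen in Hl. nra. }
  enough (Hk0 : exists k0, (forall k, (k <= n)%nat -> (k < k0)%nat -> qhat k <= p)
                           /\ pb_tail l k0 <= alpha).
  { destruct Hk0 as (k0 & Hk0 & Ht).
    pose proof (prob_sum_event_ge n q (fun k => qhat k <= p)
      (fun k => Rle_dec (qhat k) p) k0 Hq Hk0) as H. fold l in H. lra. }
  destruct (least_below (fun k => p < qhat k) (S n)) as [Hall|(k & Hkn & Hk & Hlt)].
  - exists (S n). split; [intros; apply Rnot_lt_le, Hall; lia|].
    rewrite pb_tail_gt_length by lia. lra.
  - exists k. split; [intros; now apply Rnot_lt_le, Hlt|].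
    (* Indices 0 and 1 cannot be bad, as [qhat] is 0 there and [0 <= p]; the least bad index is now
       [S (S k)]. *)
    destruct k as [|[|k]]; [lra|lra|].
    destruct (Hhat (S (S k))) as [Hx Hinc]; [lia|].
    replace (S (S k) - 1)%nat with (S k) in Hinc by lia.
    replace (n - S (S k) + 2)%nat with (n - S k + 1)%nat in Hinc by lia.
    apply is_incbeta_binomial_tail in Hinc; [|lia].
    assert (Hstrict := binomial_tail_lt n (S k) p (qhat (S (S k)))
                         ltac:(lia) (proj1 Hp) Hk (proj2 Hx)).
    rewrite <- Hinc in Hstrict.
    (* Hoeffding's bound applies when [n p <= k + 1]; otherwise the median bound gives [1/2 <=
       pb_tail (repeat p n) (S k) < alpha], which is impossible. *)
    destruct (Rle_lt_dec (INR n * p) (INR k + 1)) as [Hmean|Hmean].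
    + apply Rle_trans with (pb_tail (repeat p n) (S (S k))).
      * rewrite <- Hlen. apply pb_tail_le_binomial; rewrite ?Hlen; lra || assumption.
      * apply Rle_trans with (1 := pb_tail_decr _ _ (unit_list_repeat p n Hp)). lra.
    + pose proof (binomial_median p n (S k) Hp ltac:(lia)) as Hmed.
      rewrite S_INR in Hmed. lra.
Qed.
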